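(* For every integer $n\geq 1$, $\mathrm{ex}_{\mathcal{P}}(n,S_{2,5})\leq \frac{20}{7}n$.
   Context: All graphs are finite and simple. For a graph $F$, the planar Turán number $\mathrm{ex}_{\mathcal{P}}(n,F)$ is the maximum number of edges in an $n$-vertex planar graph that contains no subgraph isomorphic to $F$. For positive integers $m,k$, the double star $S_{m,k}$ is the tree obtained from an edge $xy$ (the backbone) by joining $x$ to $m$ new vertices and $y$ to $k$ further new vertices, all these $m+k$ vertices distinct. *)

(* Defs.v *)
From Stdlib Require Import Reals.
From mathcomp Require Import all_boot.

Set Implicit Arguments.
Unset Strict Implicit.
Unset Printing Implicit Defensive.

Definition simple_graph (T : finType) (e : rel T) : Prop :=
  (forall x y, e x y = e y x) /\ (forall x, ~~ e x x).

Definition num_edges (n : nat) (e : rel 'I_n) : nat :=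
  #|[set p : 'I_n * 'I_n | (p.1 < p.2)%N && e p.1 p.2]|.

Definition contains_subgraph (U T : finType) (f : rel U) (e : rel T) : Prop :=
  exists phi : U -> T, injective phi /\ forall a b, f a b -> e (phi a) (phi b).

(* The double star S_{m,k} on vertex set 'I_(m+k+2):
   vertex 0 = x, vertex 1 = y (backbone xy), vertices 2..m+1 are the m leaves
   joined to x, vertices m+2..m+k+1 are the k leaves joined to y. *)
Definition ds_arc (m k : nat) (a b : 'I_(m + k).+2) : bool :=
  [|| ((a == 0 :> nat) && (b == 1 :> nat)),
      ((a == 0 :> nat) && (2 <= b)%N && (b < m + 2)%N)
    | ((a == 1 :> nat) && (m + 2 <= b)%N) ].

Definition double_star (m k : nat) : rel 'I_(m + k).+2 :=
  fun a b => ds_arc a b || ds_arc b a.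
Arguments double_star : clear implicits.

Open Scope R_scope.

Definition pt := (R * R)%type.

Definition cont_curve (g : R -> pt) : Prop :=
  forall t, continuity_pt (fun s => fst (g s)) t /\
            continuity_pt (fun s => snd (g s)) t.

Definition in01 (t : R) : Prop := 0 <= t <= 1.
Definition in01o (t : R) : Prop := 0 < t < 1.

Definition planar_drawing (n : nat) (e : rel 'I_n)
    (pos : 'I_n -> pt) (arc : 'I_n -> 'I_n -> R -> pt) : Prop :=
  (forall u v, pos u = pos v -> u = v) /\
  (forall u v : 'I_n, (u < v)%N -> e u v ->
     cont_curve (arc u v) /\
     arc u v 0 = pos u /\ arc u v 1 = pos v /\
     (forall s t, in01 s -> in01 t -> arc u v s = arc u v t -> s = t) /\
     (forall t w, in01o t -> arc u v t <> pos w)) /\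
  (forall u v u' v' : 'I_n, (u < v)%N -> e u v -> (u' < v')%N -> e u' v' ->
     (u, v) <> (u', v') ->
     forall s t, in01o s -> in01o t -> arc u v s <> arc u' v' t).

Definition planar (n : nat) (e : rel 'I_n) : Prop :=
  exists pos arc, @planar_drawing n e pos arc.

Close Scope R_scope.

(* Main.v *)
(* Topology.  A planar drawing is sampled into fine chains of points such that
   edges without a common endpoint stay far apart, while adjacent edges may
   meet.  This weak notion of drawing is closed under edge contraction and it
   excludes K5: for independent edges ab and cd, follow the vector x - y around
   the boundary of (chain ab) x (chain cd) and count mod 2 how often it turns
   across the positive x-axis.  The total is 0.  Summed over the 15 pairs of
   independent edges of K5, the terms "vertex seen from edge" cancel in pairs,
   and what remains is the parity of the number of interleaved pairs
   {ac, bd} with a < b < c < d, which is 5.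

   Counting.  Hence if a vertex y is joined to every vertex of S, then S spans
   at most 2|S| - 3 edges (contract an edge of S lying in at most one triangle).
   Repeatedly delete a set of k vertices that meets at most 20k/7 edges: a
   vertex of degree at most 2; else N[y] for deg y = 7, which is a whole
   component; else N[y] for deg y = 6, each neighbor of y having at most one
   neighbor outside N[y].  N[y] meets at most 20 edges unless N(y) spans 9
   edges and sends 6 edges out; then some x in N(y) has 4 neighbors in N(y) and
   one neighbor w outside N[y], and the 8 vertices of N[y] and w meet at most
   22 edges. *)

From Coquelicot Require Compactness.
Require Import Defs.
From Stdlib Require Import Reals Lra Btauto ClassicalEpsilon.
From mathcomp Require Import all_boot zify.

(* ring_scope, loaded through Coquelicot and zify, also claims the key %R. *)
Delimit Scope R_scope with R.

Set Implicit Arguments.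
Unset Strict Implicit.
Unset Printing Implicit Defensive.

(** * Chain drawings and K5 *)

Definition vsub (u v : pt) : pt := (u.1 - v.1, u.2 - v.2)%R.

Definition near (d : R) (u v : pt) : Prop :=
  (Rabs (u.1 - v.1) < d /\ Rabs (u.2 - v.2) < d)%R.

Definition far (d : R) (u v : pt) : Prop :=
  (d <= Rabs (u.1 - v.1) \/ d <= Rabs (u.2 - v.2))%R.

(** The positive x-axis counts as upper and the negative one as lower, so exactly one of [u] and its
    opposite is upper when [u] is nonzero. *)
Definition upper (u : pt) : bool :=
  if Rlt_dec 0 u.2 then true else
  if Rlt_dec u.2 0 then false else
  if Rlt_dec 0 u.1 then true else false.

(* For u, v in a common open coordinate half-plane, this tells whether the
   segment uv crosses the positive x-axis. *)
Definition flip (u v : pt) : bool :=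
  (upper u (+) upper v) && (if Rlt_dec 0 u.1 then true else false).

Lemma flip_right u v : (0 < u.1)%R -> flip u v = upper u (+) upper v.
Proof. by move=> hu; rewrite /flip; case: Rlt_dec => // ?; rewrite andbT. Qed.

Lemma flip_left u v : (u.1 < 0)%R -> flip u v = false.
Proof. by move=> hu; rewrite /flip; case: Rlt_dec => ?; [lra | rewrite andbF]. Qed.

Lemma upper_pos u : (0 < u.2)%R -> upper u = true.
Proof. by move=> hu; rewrite /upper; case: Rlt_dec. Qed.

Lemma upper_neg u : (u.2 < 0)%R -> upper u = false.
Proof. by move=> hu; rewrite /upper; case: Rlt_dec => ?; [lra | case: Rlt_dec]. Qed.

Lemma upper_opp u v : (u.1 <> v.1 \/ u.2 <> v.2)%R ->
  upper (vsub v u) = ~~ upper (vsub u v).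
Proof.
by rewrite /upper /vsub /= => -[] /Rdichotomy[] ?; do !(case: Rlt_dec => [?|/Rnot_lt_le ?] //=); exfalso; lra.
Qed.

Lemma farP d u v : far d u v ->
  [\/ d <= u.1 - v.1, u.1 - v.1 <= - d, d <= u.2 - v.2 | u.2 - v.2 <= - d]%R.
Proof.
case; rewrite /Rabs; case: Rcase_abs => ? ?.
- by constructor 2; lra.
- by constructor 1.
- by constructor 4; lra.
- by constructor 3.
Qed.

Lemma nearP d u v : near d u v ->
  [/\ u.1 - v.1 < d, - d < u.1 - v.1, u.2 - v.2 < d & - d < u.2 - v.2]%R.
Proof. by case=> /Rabs_def2[? ?] /Rabs_def2[? ?]. Qed.

(* All four difference vectors lie in one open coordinate half-plane. *)
Lemma flip_square d x x' y y' :
  far (4 * d) x y -> near d x x' -> near d y y' ->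
  flip (vsub x y) (vsub x y') (+) flip (vsub x' y) (vsub x' y')
  = flip (vsub x y) (vsub x' y) (+) flip (vsub x y') (vsub x' y').
Proof.
move=> /farP F /nearP[? ? ? ?] /nearP[? ? ? ?].
case: F => ?.
- by rewrite !flip_right /=; first (by clear; do 4!case: upper); lra.
- by rewrite !flip_left //=; lra.
- by rewrite /flip !upper_pos //=; lra.
- by rewrite /flip !upper_neg //=; lra.
Qed.

(** Opposite vectors cross opposite halves of the x-axis, so the two flips add up to the total
    change of side. *)
Lemma flip_opp d x y y' : far (4 * d) x y -> near d y y' ->
  flip (vsub x y) (vsub x y')
  = flip (vsub y x) (vsub y' x) (+) (upper (vsub y x) (+) upper (vsub y' x)).
Proof.
move=> /farP F /nearP[? ? ? ?].
case: F => ?.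
- rewrite flip_right ?flip_left /=; [|lra..].
  rewrite !(@upper_opp _ x) /=; [by do 2!case: upper | left; lra | left; lra].
- rewrite flip_left ?flip_right /=; [|lra..].
  by rewrite addbb.
- by rewrite /flip [upper (vsub x y)]upper_pos ?[upper (vsub x y')]upper_pos
    ?[upper (vsub y x)]upper_neg ?[upper (vsub y' x)]upper_neg //=; lra.
- by rewrite /flip [upper (vsub x y)]upper_neg ?[upper (vsub x y')]upper_neg
    ?[upper (vsub y x)]upper_pos ?[upper (vsub y' x)]upper_pos //=; lra.
Qed.

(** * Turning parity along chains *)

Fixpoint chain (d : R) (x : pt) (p : seq pt) : Prop :=
  if p is y :: p' then near d x y /\ chain d y p' else True.

Lemma chain_cat d x p q :
  chain d x p -> chain d (last x p) q -> chain d x (p ++ q).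
Proof. by elim: p x => [|y p IH] x //= [? ?] ?; split=> //; apply: IH. Qed.

Definition all_far (d : R) (p q : seq pt) : Prop :=
  forall x y, List.In x p -> List.In y q -> far d x y.

Lemma all_far_tl d p y q : all_far d p (y :: q) -> all_far d p q.
Proof. by move=> F a b ? ?; apply: F => //; right. Qed.

(** A winding number mod 2: crossings of the positive x-axis by the vector from [u] to a point
    running along the chain. *)
Fixpoint turns (u x : pt) (p : seq pt) : bool :=
  if p is y :: p' then flip (vsub x u) (vsub y u) (+) turns u y p' else false.

Fixpoint opp_turns (u x : pt) (p : seq pt) : bool :=
  if p is y :: p' then flip (vsub u x) (vsub u y) (+) opp_turns u y p' else false.

Lemma opp_turnsE d u x p : chain d x p -> all_far (4 * d) [:: u] (x :: p) ->
  opp_turns u x p = turns u x p (+) (upper (vsub x u) (+) upper (vsub (last x p) u)).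
Proof.
elim: p x => [|y p IH] x /=; first by rewrite addbb.
move=> [xy cp] F; rewrite (IH y) //; last exact: all_far_tl F.
rewrite (flip_opp (d := d)) //; last by apply: F; left.
by case: flip; case: (turns u y p); do 3!case: upper.
Qed.

(** Sum [flip_square] along the chain; the inner sides cancel in pairs. *)
Lemma turns_strip d u u' x p :
  near d u u' -> chain d x p -> all_far (4 * d) [:: u] (x :: p) ->
  opp_turns u x p (+) opp_turns u' x p
  = flip (vsub u x) (vsub u' x) (+) flip (vsub u (last x p)) (vsub u' (last x p)).
Proof.
move=> uu'; elim: p x => [|y p IH] x /=; first by rewrite addbb.
move=> [xy cp] F.
have /= := IH y cp (all_far_tl F).
have := flip_square (F u x (or_introl erefl) (or_introl erefl)) uu' xy.
set a := flip _ _; set b := flip _ _; set c := flip _ _; set e := flip _ _.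
set f := opp_turns _ _ _; set g := opp_turns _ _ _; set k := flip _ _.
by case: a b c e f g k => [] [] [] [] [] [] [].
Qed.

(** Stack the strips of [turns_strip]: far chains keep the difference vector away from 0, so the
    parity round the boundary of the product vanishes. *)
Lemma turns_rectangle d u p x q :
  chain d u p -> chain d x q -> all_far (4 * d) (u :: p) (x :: q) ->
  opp_turns u x q (+) opp_turns (last u p) x q
  = turns x u p (+) turns (last x q) u p.
Proof.
elim: p u => [|u' p IH] u /=; first by rewrite addbb.
move=> [uu' cp] cq F.
have F' : all_far (4 * d) (u' :: p) (x :: q) by move=> a b ? ?; apply: F => //; right.
have := IH u' cp cq F'.
have F1 : all_far (4 * d) [:: u] (x :: q) by move=> a b [<-|//] ?; apply: F => //; left.
have := turns_strip uu' cq F1.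
set a := flip _ _; set b := flip _ _; set c := turns _ _ _; set e := turns _ _ _.
set f := opp_turns _ _ _; set g := opp_turns _ _ _; set k := opp_turns _ _ _.
by case: a b c e f g k => [] [] [] [] [] [] [].
Qed.

Definition edge_chain (T : Type) (pos : T -> pt) (ch : T -> T -> seq pt)
  (u v : T) : seq pt := pos u :: ch u v.

(* A drawing up to resolution d: edges are d-chains, and two edges without a
   common endpoint stay far apart, while adjacent edges may meet. *)
Definition chain_drawable (T : eqType) (e : rel T) : Prop :=
  exists d (pos : T -> pt) (ch : T -> T -> seq pt),
  [/\ (0 < d)%R,
      forall u v, e u v -> chain d (pos u) (ch u v) /\ last (pos u) (ch u v) = pos v
    & forall u v w t, e u v -> e w t -> u != w -> u != t -> v != w -> v != t ->
      all_far (4 * d) (edge_chain pos ch u v) (edge_chain pos ch w t)].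

Lemma last_In (A : Type) (x : A) p : List.In (last x p) (x :: p).
Proof. by elim: p x => [|y p IH] x; [left | right; apply: IH]. Qed.

Lemma addb_xorb a b : a (+) b = xorb a b.
Proof. by case: a. Qed.

Lemma no_K5 (T : eqType) (e : rel T) (a b c d f : T) :
  chain_drawable e -> uniq [:: a; b; c; d; f] ->
  e a b -> e a c -> e a d -> e a f -> e b c -> e b d -> e b f ->
  e c d -> e c f -> e d f -> False.
Proof.
move=> [dl [pos [ch [d0 C F]]]].
pose k x u v := turns (pos x) (pos u) (ch u v).
pose o x y := upper (vsub (pos y) (pos x)).
(* The boundary identity for one pair of independent edges: the [k] terms are vertices seen from
   edges, the [o] terms come from [opp_turnsE]. *)
have Q u v w t : e u v -> e w t -> u != w -> u != t -> v != w -> v != t ->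
   [/\ (k u w t (+) k v w t) (+) (k w u v (+) k t u v)
       = (o u w (+) o u t) (+) (o v w (+) o v t),
       o v w = ~~ o w v & o v t = ~~ o t v].
  move=> euv ewt h1 h2 h3 h4; have f4 := F _ _ _ _ euv ewt h1 h2 h3 h4.
  have [c1 l1] := C _ _ euv; have [c2 l2] := C _ _ ewt.
  have v_in : List.In (pos v) (pos u :: ch u v) by rewrite -{1}l1; apply: last_In.
  have t_in : List.In (pos t) (pos w :: ch w t) by rewrite -{1}l2; apply: last_In.
  split.
  - have := turns_rectangle c1 c2 f4; rewrite l1 l2.
    rewrite (opp_turnsE c2) => [|x y [<-|//]]; last by apply: f4; left.
    rewrite (opp_turnsE c2) => [|x y [<-|//]]; last exact: f4.
    rewrite l2 -!/(k _ _ _) -!/(o _ _).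
    by case: (k u w t) (k v w t) (k w u v) (k t u v) => [] [] [] []; do 4!case: (o _ _).
  - by apply: upper_opp; case/farP: (f4 _ (pos w) v_in (or_introl erefl)) => ?;
      [left|left|right|right]; lra.
  - by apply: upper_opp; case/farP: (f4 _ _ v_in t_in) => ?;
      [left|left|right|right]; lra.
rewrite /= !inE !negb_or andbT => /and4P[/and4P[ab ac ad af] /and3P[bc bd bf] /andP[cd cf] df].
move=> eab eac ead eaf ebc ebd ebf ecd ecf edf.
have [cb db dc] : [/\ c != b, d != b & d != c] by rewrite !(eq_sym _ b) (eq_sym d).
have [fb fc fd] : [/\ f != b, f != c & f != d] by rewrite !(eq_sym f).
(* Every difference vector is reoriented from the earlier to the later vertex
   of a, b, c, d, f. *)
have [E1 _ _] := Q _ _ _ _ eab ecd ac ad bc bd.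
have [E2 _ _] := Q _ _ _ _ eab ecf ac af bc bf.
have [E3 _ _] := Q _ _ _ _ eab edf ad af bd bf.
have [E4 R1 _] := Q _ _ _ _ eac ebd ab ad cb cd.
rewrite R1 in E4; clear R1.
have [E5 R1 _] := Q _ _ _ _ eac ebf ab af cb cf.
rewrite R1 in E5; clear R1.
have [E6 _ _] := Q _ _ _ _ eac edf ad af cd cf.
have [E7 R1 R2] := Q _ _ _ _ ead ebc ab ac db dc.
rewrite R1 R2 in E7; clear R1 R2.
have [E8 R1 _] := Q _ _ _ _ ead ebf ab af db df.
rewrite R1 in E8; clear R1.
have [E9 R1 _] := Q _ _ _ _ ead ecf ac af dc df.
rewrite R1 in E9; clear R1.
have [E10 R1 R2] := Q _ _ _ _ eaf ebc ab ac fb fc.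
rewrite R1 R2 in E10; clear R1 R2.
have [E11 R1 R2] := Q _ _ _ _ eaf ebd ab ad fb fd.
rewrite R1 R2 in E11; clear R1 R2.
have [E12 R1 R2] := Q _ _ _ _ eaf ecd ac ad fc fd.
rewrite R1 R2 in E12; clear R1 R2.
have [E13 _ _] := Q _ _ _ _ ebc edf bd bf cd cf.
have [E14 R1 _] := Q _ _ _ _ ebd ecf bc bf dc df.
rewrite R1 in E14; clear R1.
have [E15 R1 R2] := Q _ _ _ _ ebf ecd bc bd fc fd.
rewrite R1 R2 in E15; clear R1 R2.
(* In the sum each [k] occurs twice and each [o] six times. What is left are the negations: one from
   each interleaved pair [E4], [E5], [E8], [E9], [E14], and two or none from the others. *)
have H := congr2 addb E1 (congr2 addb E2 (congr2 addb E3 (congr2 addb E4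
  (congr2 addb E5 (congr2 addb E6 (congr2 addb E7 (congr2 addb E8
  (congr2 addb E9 (congr2 addb E10 (congr2 addb E11 (congr2 addb E12
  (congr2 addb E13 (congr2 addb E14 E15))))))))))))).
rewrite !addb_xorb in H.
match type of H with ?l = ?r => have X : xorb l r = true by btauto end.
by move: X; rewrite H Bool.xorb_nilpotent.
Qed.

(* [z] is merged into [x]; it stays in the type as an isolated vertex. *)
Definition contract (T : eqType) (e : rel T) (x z : T) : rel T := fun a b =>
  [&& a != b, a != z, b != z & [|| e a b, (a == x) && e z b | (b == x) && e a z]].

(** An edge moved from [z] to [x] runs along the old chains through [z]; it may overlap other edges
    at [x], which is allowed. *)
Lemma contract_drawable (T : eqType) (e : rel T) (x z : T) :
  symmetric e -> e x z -> chain_drawable e -> chain_drawable (contract e x z).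
Proof.
move=> sym exz [d [pos [ch [d0 C F]]]].
have ezx : e z x by rewrite sym.
pose ch' u v := if e u v then ch u v else
  if (u == x) && e z v then ch x z ++ ch z v else ch u z ++ ch z x.
exists d, pos, ch'; split=> // [u v /and4P[_ _ _]|].
  rewrite /ch'; case: ifP => [euv _|_ /= E]; first exact: C.
  case: ifP E => [/andP[/eqP-> ezv] _|_ /= /andP[/eqP-> euz]].
    have [c l] := C _ _ exz; have [c' l'] := C _ _ ezv.
    by rewrite last_cat l; split=> //; apply: chain_cat; rewrite ?l.
  have [c l] := C _ _ euz; have [c' l'] := C _ _ ezx.
  by rewrite last_cat l; split=> //; apply: chain_cat; rewrite ?l.
(* Every point of a new chain lies on an old edge whose ends are ends of the new one, or [z] if [x]
   is such an end. Independent new edges thus use independent old ones. *)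
have K u v p : contract e x z u v -> List.In p (edge_chain pos ch' u v) ->
    exists a b, [/\ e a b, List.In p (edge_chain pos ch a b) &
      forall c, c \in [:: a; b] -> c \in [:: u; v] \/ c = z /\ x \in [:: u; v]].
  case/and4P=> _ _ _; rewrite /ch' /edge_chain.
  case: ifP => [euv _ pin|_ /=]; first by exists u, v; split=> // c; left.
  case: ifP => [/andP[/eqP-> ezv] _|_ /= /andP[/eqP-> euz]].
    case=> [<-|/List.in_app_iff[pin|pin]].
    - exists x, z; split=> //; first by left.
      move=> c; rewrite !inE => /orP[]/eqP->; [left | right]; by rewrite eqxx.
    - exists x, z; split=> //; first by right.
      move=> c; rewrite !inE => /orP[]/eqP->; [left | right]; by rewrite eqxx.
    - exists z, v; split=> //; first by right.
      move=> c; rewrite !inE => /orP[]/eqP->; [right | left]; by rewrite eqxx ?orbT.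
  case=> [<-|/List.in_app_iff[pin|pin]].
  - exists u, z; split=> //; first by left.
    move=> c; rewrite !inE => /orP[]/eqP->; [left | right]; by rewrite eqxx ?orbT.
  - exists u, z; split=> //; first by right.
    move=> c; rewrite !inE => /orP[]/eqP->; [left | right]; by rewrite eqxx ?orbT.
  - exists z, x; split=> //; first by right.
    move=> c; rewrite !inE => /orP[]/eqP->; [right | left]; by rewrite eqxx ?orbT.
move=> u v w t euv ewt uw ut vw vt p q pin qin.
have [a [b [eab pab ab]]] := K _ _ _ euv pin.
have [a' [b' [eab' qab ab']]] := K _ _ _ ewt qin.
have D c c' : c \in [:: a; b] -> c' \in [:: a'; b'] -> c != c'.
  move=> /ab H /ab' H'; apply/eqP=> E; subst c'.
  have I s : s \in [:: u; v] -> s \in [:: w; t] -> False.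
    by rewrite !inE => /orP[]/eqP-> /orP[]; apply/negP.
  have [/and4P[_ uz vz _] /and4P[_ wz tz _]] := (euv, ewt).
  case: H H' => [H|[Hz H]] [H'|[Hz' H']].
  - exact: I H H'.
  - by move: H; rewrite Hz' !inE !(eq_sym z) (negbTE uz) (negbTE vz).
  - by move: H'; rewrite Hz !inE !(eq_sym z) (negbTE wz) (negbTE tz).
  - exact: I H H'.
by apply: (F _ _ _ _ eab eab') => //; apply: D; rewrite !inE eqxx ?orbT.
Qed.

(** * From planar drawings to chain drawings *)

Lemma far_le d d' u v : (d' <= d)%R -> far d u v -> far d' u v.
Proof. by move=> le [] ?; [left | right]; lra. Qed.

Lemma continuity_pt_near f x d : continuity_pt f x -> (0 < d)%R ->
  exists2 a, (0 < a)%R & forall y, (Rabs (y - x) < a)%R -> (Rabs (f y - f x) < d)%R.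
Proof.
move=> fc d0; have [a [a0 H]] := fc d d0; exists a => // y yx.
(* [continuity_pt] speaks only of [y] different from [x]. *)
have [->|ne] := Req_dec x y; first by rewrite Rminus_diag Rabs_R0.
exact: (H y).
Qed.

Lemma coordinate_gap f g x y : continuity_pt f x -> continuity_pt g y -> f x <> g y ->
  exists d : posreal, forall s t, (Rabs (s - x) < d)%R -> (Rabs (t - y) < d)%R ->
    (d <= Rabs (f s - g t))%R.
Proof.
move=> fx gy ne; set D := Rabs (f x - g y).
have D0 : (0 < D)%R by apply: Rabs_pos_lt; lra.
(* Each value moves by less than [D / 4], which leaves a gap above [D / 2]. *)
have [a a0 Ha] := continuity_pt_near fx (d := D / 4) ltac:(lra).
have [b b0 Hb] := continuity_pt_near gy (d := D / 4) ltac:(lra).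
have m0 : (0 < Rmin (D / 4) (Rmin a b))%R by apply: Rmin_pos; [lra | apply: Rmin_pos].
exists (mkposreal _ m0) => s t /= sx ty.
have m1 := Rmin_l (D / 4) (Rmin a b); have m2 := Rmin_r (D / 4) (Rmin a b).
have m3 := Rmin_l a b; have m4 := Rmin_r a b.
have {}Ha := Ha s ltac:(lra); have {}Hb := Hb t ltac:(lra).
move: Ha Hb; rewrite /D in m1 *; split_Rabs; lra.
Qed.

(** Compactness of the unit square turns the local gaps into one positive lower bound. *)
Lemma disjoint_curves_far (g h : R -> pt) :
  cont_curve g -> cont_curve h ->
  (forall s t, in01 s -> in01 t -> g s <> h t) ->
  exists2 d, (0 < d)%R & forall s t, in01 s -> in01 t -> far d (g s) (h t).
Proof.
move=> cg ch dis.
have loc x y : exists d : posreal, in01 x -> in01 y ->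
    forall s t, (Rabs (s - x) < d)%R -> (Rabs (t - y) < d)%R -> far d (g s) (h t).
  have [xy|nxy] := classic (in01 x /\ in01 y); last first.
    (* A dummy value outside the unit square. *)
    by exists (mkposreal 1 Rlt_0_1) => *; case: nxy.
  have [ne|ne] : (g x).1 <> (h y).1 \/ (g x).2 <> (h y).2.
    have [e1|] := Req_dec (g x).1 (h y).1; last by left.
    have [e2|] := Req_dec (g x).2 (h y).2; last by right.
    case: (dis x y) => //; first by tauto. by tauto.
    by rewrite [g x]surjective_pairing [h y]surjective_pairing e1 e2.
  - have [d H] := coordinate_gap (cg x).1 (ch y).1 ne.
    by exists d => _ _ s t sx ty; left; apply: H.
  - have [d H] := coordinate_gap (cg x).2 (ch y).2 ne.
    by exists d => _ _ s t sx ty; right; apply: H.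
pose dl x y := proj1_sig (constructive_indefinite_description _ (loc x y)).
have dlP x y := proj2_sig (constructive_indefinite_description _ (loc x y)).
have [d H] := Compactness.compactness_value_2d 0 1 0 1 dl.
exists d => [|s t s01 t01]; first exact: cond_pos.
(* The compactness result provides the nearby base point only under a double negation. *)
apply: NNPP => nf; apply: (H s t s01 t01) => -[x [y [x01 [y01 [sx [ty le]]]]]].
by apply: nf; apply: far_le le _; apply: dlP.
Qed.

(** Sample at [N] equal steps, with 1/N below the moduli of uniform continuity of both
    coordinates. *)
Lemma curve_chain (g : R -> pt) d : cont_curve g -> (0 < d)%R ->
  exists p, [/\ chain d (g 0%R) p, last (g 0%R) p = g 1%R
    & forall x, List.In x (g 0%R :: p) -> exists2 t, in01 t & x = g t].
Proof.
move=> cg d0.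
have uc f : (forall t, continuity_pt f t) -> exists a : posreal, forall s t,
    in01 s -> in01 t -> (Rabs (s - t) < a)%R -> (Rabs (f s - f t) < d)%R.
  move=> fc; have [a H] := Heine f (fun t => 0 <= t <= 1)%R (compact_P3 0 1)
    (fun t _ => fc t) (mkposreal _ d0).
  by exists a => s t s01 t01; apply: H.
have [a Ha] := uc _ (fun t => (cg t).1); have [b Hb] := uc _ (fun t => (cg t).2).
have [N [N0 HN]] : exists N, (0 < N)%N /\ (/ INR N < Rmin a b)%R.
  have [N [H1 H2]] := archimed_cor1 (Rmin a b) (Rmin_pos _ _ (cond_pos a) (cond_pos b)).
  by exists N; split=> //; apply/ltP.
have N0' : (0 < INR N)%R by apply: lt_0_INR; apply/ltP.
pose f i := g (INR i / INR N)%R.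
have in01_frac i : (i <= N)%N -> in01 (INR i / INR N).
  move=> /leP /le_INR iN; have i0 := pos_INR i; split.
    by apply: Rmult_le_pos => //; apply/Rlt_le/Rinv_0_lt_compat.
  by apply: (Rmult_le_reg_r (INR N)) => //; field_simplify; lra.
have f0 : f 0 = g 0%R by rewrite /f /Rdiv Rmult_0_l.
have fN : f N = g 1%R by rewrite /f /Rdiv Rinv_r //; lra.
have m1 := Rmin_l a b; have m2 := Rmin_r a b.
have step i : (i < N)%N -> near d (f i) (f i.+1).
  move=> iN; have d1 : (Rabs (INR i / INR N - INR i.+1 / INR N) < Rmin a b)%R.
    rewrite S_INR (_ : _ - _ = - / INR N)%R; last by field; lra.
    by rewrite Rabs_Ropp Rabs_pos_eq //; apply/Rlt_le/Rinv_0_lt_compat.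
  by split; [apply: Ha | apply: Hb]; try apply: in01_frac; try lra; rewrite // ltnW.
have key m i : (i + m = N)%N -> [/\ chain d (f i) (map f (iota i.+1 m)),
    last (f i) (map f (iota i.+1 m)) = f N
    & forall x, List.In x (f i :: map f (iota i.+1 m)) -> exists2 j, (j <= N)%N & x = f j].
  elim: m i => [|m IH] i iN /=.
    split=> //; first by rewrite -iN addn0.
    by move=> x [<-|//]; exists i; rewrite // -iN leq_addr.
  have [c l I] := IH i.+1 ltac:(by rewrite addSnnS).
  have iN' : (i < N)%N by rewrite -iN addnS ltnS leq_addr.
  split=> //; first by split=> //; apply: step.
  by move=> x [<-|/I//]; exists i; rewrite // ltnW.
have [c l I] := key N 0%N (add0n N).
exists (map f (iota 1 N)); rewrite -f0 -fN; split=> // x /I[j jN ->].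
by exists (INR j / INR N)%R => //; apply: in01_frac.
Qed.

Lemma common_scale (I : finType) (P : I -> R -> Prop) :
  (forall i d d', (d' <= d)%R -> P i d -> P i d') ->
  (forall i, exists2 d, (0 < d)%R & P i d) ->
  exists2 d, (0 < d)%R & forall i, P i d.
Proof.
move=> mono ex.
have [d d0 H] : exists2 d, (0 < d)%R & forall i, i \in enum I -> P i d.
  elim: (enum I) => [|i s [d d0 H]]; first by exists 1%R => //; lra.
  have [d' d'0 H'] := ex i.
  exists (Rmin d d') => [|j]; first exact: Rmin_pos.
  by rewrite inE => /orP[/eqP->|/H]; [apply: mono H'; exact: Rmin_r | apply: mono; exact: Rmin_l].
by exists d => // i; apply: H; rewrite mem_enum.
Qed.

(** Arcs of independent edges are disjoint, endpoints included, so a finite minimum gives one gap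
    [d]. The step is [d / 4], since [chain_drawable] asks for a gap of four steps. *)
Lemma planar_chain_drawable n (e : rel 'I_n) :
  simple_graph e -> planar e -> chain_drawable e.
Proof.
move=> [sym irr] [pos [arc [inj [A D]]]].
(* [arc] is constrained only for [u < v]; the other direction is the same arc run backwards. *)
pose g (u v : 'I_n) t := if (u < v)%N then arc u v t else arc v u (1 - t)%R.
have neq u v : e u v -> u != v by apply: contraTneq => ->.
have lt_or u v : e u v -> ((u < v) || (v < u))%N by move/neq; rewrite -neq_ltn.
have G u v : e u v -> [/\ cont_curve (g u v), g u v 0%R = pos u & g u v 1%R = pos v].
  move=> euv; rewrite /g; case: ltnP (lt_or _ _ euv) => [uv _|_ /= vu].
    by have [? [? []]] := A _ _ uv euv.
  rewrite sym in euv; have [c [a0 [a1 _]]] := A _ _ vu euv.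
  rewrite Rminus_0_r Rminus_diag; split=> // t.
  have c1 : continuity_pt (fun s => 1 - s)%R t by reg.
  split.
    exact: (continuity_pt_comp (fun s => 1 - s)%R (fun s => (arc v u s).1) t c1 (c _).1).
  exact: (continuity_pt_comp (fun s => 1 - s)%R (fun s => (arc v u s).2) t c1 (c _).2).
have K u v s : e u v -> in01 s -> exists (a b : 'I_n) r, [/\ (a < b)%N, e a b, in01 r,
    g u v s = arc a b r & perm_eq [:: a; b] [:: u; v]].
  move=> euv s01; rewrite /g; case: ltnP (lt_or _ _ euv) => [uv _|_ /= vu].
    by exists u, v, s; split.
  exists v, u, (1 - s)%R; split=> //; first by rewrite sym.
    by move: s01; rewrite /in01; lra.
  exact/permPl/(perm_catC [:: v] [:: u]).
have in01E s : in01 s -> [\/ s = 0%R, s = 1%R | in01o s].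
  rewrite /in01 /in01o => s01.
  have [->|] := Req_dec s 0; first by constructor 1.
  have [->|] := Req_dec s 1; first by constructor 2.
  by constructor 3; lra.
(* The drawing separates interiors of arcs from each other and from vertices, so endpoint parameters
   are treated apart. *)
have dis (a b c f : 'I_n) s t : (a < b)%N -> e a b -> (c < f)%N -> e c f ->
    a != c -> a != f -> b != c -> b != f -> in01 s -> in01 t -> arc a b s <> arc c f t.
  move=> ab eab cf ecf /eqP ac /eqP af /eqP bc /eqP bf s01 t01.
  have [_ [a0 [a1 [_ ai]]]] := A _ _ ab eab; have [_ [c0 [c1 [_ ci]]]] := A _ _ cf ecf.
  case: (in01E s s01) => [->|->|si]; case: (in01E t t01) => [->|->|ti];
    rewrite ?a0 ?a1 ?c0 ?c1.
  1,2,4,5: by move/inj.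
  1,2: by apply: nesym; apply: ci.
  1,2: exact: ai.
  by apply: (D _ _ _ _ ab eab cf ecf) => // -[].
have [d d0 Hd] : exists2 d, (0 < d)%R & forall q : 'I_n * 'I_n * ('I_n * 'I_n),
    e q.1.1 q.1.2 -> e q.2.1 q.2.2 -> q.1.1 != q.2.1 -> q.1.1 != q.2.2 ->
    q.1.2 != q.2.1 -> q.1.2 != q.2.2 ->
    forall s t, in01 s -> in01 t -> far d (g q.1.1 q.1.2 s) (g q.2.1 q.2.2 t).
  apply: common_scale => [q d d' le H h1 h2 h3 h4 h5 h6 s t s01 t01|[[u v] [w t]] /=].
    by apply: far_le le _; apply: H.
  case: (boolP [&& e u v, e w t, u != w, u != t, v != w & v != t]); last first.
    by move=> nH; exists 1%R => [|*]; [lra | case/negP: nH; apply/and5P; split=> //; apply/andP].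
  case/and5P=> euv ewt uw ut /andP[vw vt].
  have [c _ _] := G _ _ euv; have [c' _ _] := G _ _ ewt.
  have [|d d0 H] := disjoint_curves_far c c'; last by exists d.
  move=> s r s01 r01.
  have [a [b [s' [ab eab s01' -> /perm_mem E]]]] := K _ _ _ euv s01.
  have [a' [b' [r' [ab' eab' r01' -> /perm_mem E']]]] := K _ _ _ ewt r01.
  have N x y : x \in [:: a; b] -> y \in [:: a'; b'] -> x != y.
    by rewrite E E' !inE => /orP[]/eqP-> /orP[]/eqP->.
  by apply: dis => //; apply: N; rewrite !inE eqxx ?orbT.
have ex (q : 'I_n * 'I_n) : exists p : seq pt, e q.1 q.2 ->
    [/\ chain (d / 4) (pos q.1) p, last (pos q.1) p = pos q.2
    & forall x, List.In x (pos q.1 :: p) -> exists2 t, in01 t & x = g q.1 q.2 t].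
  case: q => u v /=; have [euv|] := boolP (e u v); last by exists [::].
  have [c g0 g1] := G _ _ euv.
  have [p] := curve_chain (d := d / 4) c ltac:(lra).
  by rewrite g0 g1 => H; exists p.
have [ch Hch] := fin_all_exists ex.
exists (d / 4)%R, pos, (fun u v => ch (u, v)); split; first lra.
  by move=> u v euv; have [] := Hch (u, v) euv.
move=> u v w t euv ewt uw ut vw vt x y.
have [_ _ I] := Hch (u, v) euv; have [_ _ J] := Hch (w, t) ewt.
move=> /I[s s01 ->] /J[r r01 ->].
rewrite (_ : 4 * _ = d)%R; last by field.
exact: (Hd (u, v, (w, t))).
Qed.

(** * Edge counts below an apex vertex *)

Section DegreeSums.
Variables (T : finType) (e : rel T).
Implicit Types (S X : {set T}) (x y z : T).

Definition nbhd S x : {set T} := [set z in S | e x z].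

Definition deg S x : nat := #|nbhd S x|.

(* The handshake sum: twice the number of edges inside [S]. *)
Definition edge_sum S : nat := \sum_(x in S) deg S x.

Lemma nbhdP S x z : (z \in nbhd S x) = (z \in S) && e x z.
Proof. by rewrite inE. Qed.

Lemma degE S x : deg S x = \sum_(z in S) e x z.
Proof.
rewrite /deg -sum1_card (eq_bigl (fun z => (z \in S) && e x z)) => [|z]; last exact: nbhdP.
by rewrite big_mkcondr; apply: eq_bigr => z _; case: (e x z).
Qed.

Lemma deg_setD S X x : X \subset S -> deg S x = deg X x + deg (S :\: X) x.
Proof. by move=> /setIidPr XS; rewrite !degE (big_setID X) XS. Qed.

Hypothesis sym : symmetric e.
Hypothesis irr : irreflexive e.

Lemma edge_sum_setD S X : X \subset S ->
  edge_sum S = edge_sum (S :\: X) + edge_sum X + 2 * \sum_(x in X) deg (S :\: X) x.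
Proof.
move=> XS; rewrite /edge_sum (big_setID X) /= (setIidPr XS).
rewrite !(eq_bigr _ (fun x _ => deg_setD x XS)) !big_split /=.
(* Edges between [X] and the rest can be counted from either side. *)
suff -> : \sum_(x in S :\: X) deg X x = \sum_(x in X) deg (S :\: X) x by lia.
rewrite !(eq_bigr _ (fun x _ => degE _ x)) exchange_big /=.
by apply: eq_bigr => x _; apply: eq_bigr => z _; rewrite sym.
Qed.

Lemma edge_sum1 x : edge_sum [set x] = 0.
Proof. by rewrite /edge_sum big_set1 degE big_set1 irr. Qed.

Lemma deg_setD1 S x : x \in S -> deg (S :\ x) x = deg S x.
Proof.
by move=> xS; rewrite (@deg_setD S [set x]) ?sub1set // [deg [set x] x]degE big_set1 irr.
Qed.

Lemma edge_sum_setD1 S x : x \in S ->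
  edge_sum S = edge_sum (S :\ x) + 2 * deg S x.
Proof.
move=> xS; rewrite (@edge_sum_setD S [set x]) ?sub1set // edge_sum1 big_set1.
by rewrite deg_setD1 // addn0.
Qed.

Lemma edge_sum_even S : ~~ odd (edge_sum S).
Proof.
have [m] := ubnP #|S|; elim: m S => // m IH S leS.
have [->|[x xS]] := set_0Vmem S; first by rewrite /edge_sum big_set0.
rewrite (edge_sum_setD1 xS) oddD mul2n odd_double addbF IH //.
by move: leS; rewrite (cardsD1 x S) xS.
Qed.

Lemma deg_lt S x : x \in S -> deg S x < #|S|.
Proof.
move=> xS; apply: proper_card; apply/properP; split; first by apply/subsetP => z; rewrite inE => /andP[].
by exists x; rewrite // inE irr andbF.
Qed.

Lemma edge_sum_le S k : (forall x, x \in S -> deg S x <= k) -> edge_sum S <= k * #|S|.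
Proof. by move=> H; rewrite mulnC -sum_nat_const; apply: leq_sum. Qed.

Lemma edge_sum_ge S k : (forall x, x \in S -> k <= deg S x) -> k * #|S| <= edge_sum S.
Proof. by move=> H; rewrite mulnC -sum_nat_const; apply: leq_sum. Qed.

Lemma edge_sum_gt0 S : 0 < edge_sum S -> exists x z, [/\ x \in S, z \in S & e x z].
Proof.
rewrite lt0n sum_nat_eq0 => /forallPn[x]; rewrite negb_imply => /andP[xS].
by rewrite -lt0n => /card_gt0P[z]; rewrite inE => /andP[zS xz]; exists x, z.
Qed.

End DegreeSums.

(** * Edge counts under contraction *)

Lemma contract_sym (T : eqType) (e : rel T) x z : symmetric e -> symmetric (contract e x z).
Proof.
move=> sym a b; rewrite /contract (eq_sym b a) (sym b a) (sym z a) (sym b z) [(b == x) && _ || _]orbC.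
by rewrite [(a != z) && _]andbCA.
Qed.

Lemma contract_irr (T : eqType) (e : rel T) x z : irreflexive (contract e x z).
Proof. by move=> a; rewrite /contract eqxx. Qed.

(** Contracting [x z] loses that edge and one edge for each common neighbor; each lost edge counts
    twice. *)
Lemma edge_sum_contract (T : finType) (e : rel T) (S : {set T}) x z :
  symmetric e -> irreflexive e -> x \in S -> z \in S -> e x z ->
  edge_sum e S <=
    edge_sum (contract e x z) (S :\ z) + 2 + 2 * deg e (nbhd e S x) z.
Proof.
move=> sym irr xS zS exz; set e' := contract e x z.
have xz : x != z by apply: contraTneq exz => ->; rewrite irr.
have xSz : x \in S :\ z by rewrite !inE xz.
pose R := S :\ z :\ x.
have eR a : a \in R -> [/\ a != x, a != z & a \in S] by rewrite !inE => /and3P[].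
have R1 : edge_sum e' R = edge_sum e R.
  apply: eq_bigr => a /eR[ax az _]; rewrite !degE; apply: eq_bigr => b /eR[bx bz _].
  rewrite /e' /contract az bz (negbTE ax) (negbTE bx) !orbF /=.
  by have [->|] := eqVneq a b; rewrite ?irr.
(* The union of the two neighborhoods goes to the merged vertex, their intersection to the common
   neighbors. *)
have R2 : deg e R x + deg e R z <= deg e' R x + deg e (nbhd e S x) z.
  rewrite /deg -cardsUI leq_add //; apply: subset_leq_card; apply/subsetP => b.
    rewrite in_setU !nbhdP => /orP[]/andP[bR eb]; have [bx bz _] := eR _ bR.
      by rewrite bR /e' /contract eq_sym bx xz bz eb.
    by rewrite bR /e' /contract eq_sym bx xz bz eqxx eb orbT.
  by rewrite in_setI !nbhdP => /andP[/andP[/eR[_ _ ->] ->] /andP[_ ->]].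
have D1 : deg e S z = deg e R z + 1.
  rewrite -(deg_setD1 irr zS) (@deg_setD _ _ (S :\ z) [set x]) ?sub1set // addnC.
  by rewrite [deg _ [set x] z]degE big_set1 sym exz.
have irr' : irreflexive e' by exact: contract_irr.
have sym' : symmetric e' by exact: contract_sym.
rewrite (edge_sum_setD1 sym irr zS) (edge_sum_setD1 sym irr xSz).
rewrite (edge_sum_setD1 sym' irr' xSz) -(deg_setD1 irr xSz) -(deg_setD1 irr' xSz).
rewrite -/R; lia.
Qed.

Section SmallMinors.
Variable T : finType.
Implicit Types (e : rel T) (S : {set T}) (x y z : T).

(* Contracting an edge in no triangle of [S] loses one edge; an edge in a
   triangle gives a K5 together with [x] and [y]. *)
Lemma double_apex_bound e x y S :
  symmetric e -> irreflexive e -> chain_drawable e ->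
  e x y -> x \notin S -> y \notin S -> (forall z, z \in S -> e x z && e y z) ->
  0 < #|S| -> edge_sum e S + 2 <= 2 * #|S|.
Proof.
have [m] := ubnP #|S|; elim: m S e => // m IH S e leS sym irr dr exy xS yS ad S0.
have [/eqP->|] := boolP (edge_sum e S == 0); first by lia.
rewrite -lt0n => /edge_sum_gt0[a [b [aS bS eab]]].
have neq u v : e u v -> u != v by apply: contraTneq => ->; rewrite irr.
have nS u v : u \in S -> v \notin S -> u != v by move=> uS; apply: contraNneq => <-.
have [c0|] := posnP (deg e (nbhd e S a) b); last first.
  move=> /card_gt0P[c]; rewrite !nbhdP => /andP[/andP[cS' eac] ebc].
  have /andP[xa ya] := ad a aS; have /andP[xb yb] := ad b bS; have /andP[xc yc] := ad c cS'.
  exfalso; apply: (no_K5 (a := x) (b := y) (c := a) (d := b) (f := c) dr) => //.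
  by rewrite /= !inE !negb_or !neq.
have cSb : #|S| = #|S :\ b|.+1 by rewrite (cardsD1 b S) bS.
have := edge_sum_contract sym irr aS bS eab.
have ab := neq _ _ eab.
have xb : x != b by rewrite eq_sym nS.
have yb : y != b by rewrite eq_sym nS.
set e' := contract e a b => le.
have sub u v : e u v -> u != b -> v != b -> e' u v.
  by move=> euv ub vb; rewrite /e' /contract neq // ub vb euv.
have IH' : edge_sum e' (S :\ b) + 2 <= 2 * #|S :\ b|.
  apply: IH.
  - by rewrite -cSb.
  - exact: contract_sym.
  - exact: contract_irr.
  - exact: contract_drawable.
  - exact: sub.
  - by rewrite inE (negbTE xS) andbF.
  - by rewrite inE (negbTE yS) andbF.
  - move=> z /setD1P[zb zS]; have /andP[xz yz] := ad z zS.
    by rewrite !sub.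
  - by apply/card_gt0P; exists a; rewrite !inE ab.
rewrite c0 in le; clear -le IH' cSb; lia.
Qed.

Lemma apex_contract e y S a b :
  symmetric e -> irreflexive e -> chain_drawable e ->
  y \notin S -> (forall z, z \in S -> e y z) -> b \in S -> e a b ->
  [/\ symmetric (contract e a b), irreflexive (contract e a b),
    chain_drawable (contract e a b), y \notin S :\ b &
    forall z, z \in S :\ b -> contract e a b y z].
Proof.
move=> sym irr dr yS ad bS eab; split.
- exact: contract_sym.
- exact: contract_irr.
- exact: contract_drawable.
- by rewrite inE (negbTE yS) andbF.
- move=> z /setD1P[zb zS]; have nS u : u \in S -> y != u by apply: contraTneq => <-.
  by rewrite /contract !nS // zb ad.
Qed.

(* If every edge of [S] lies in two triangles, then the graph on N(a) has
   minimum degree 2, against [double_apex_bound]. *)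
Lemma apex_bound e y S :
  symmetric e -> irreflexive e -> chain_drawable e ->
  y \notin S -> (forall z, z \in S -> e y z) ->
  1 < #|S| -> edge_sum e S + 6 <= 4 * #|S|.
Proof.
have [m] := ubnP #|S|; elim: m S e => // m IH S e leS sym irr dr yS ad S1.
have [small|S2] := leqP #|S| 2.
  have S2 : #|S| = 2 by apply/eqP; rewrite eqn_leq small.
  have : edge_sum e S <= 1 * #|S| by apply: edge_sum_le => x /(deg_lt irr); rewrite S2.
  by rewrite S2; clear; lia.
(* Contracting an edge in at most one triangle costs at most 4 in [edge_sum], exactly what one
   vertex pays for. *)
have [/existsP[[a b]] /and4P[/= aS bS eab codeg]|nex] :=
  boolP [exists p : T * T, [&& p.1 \in S, p.2 \in S, e p.1 p.2 &
    deg e (nbhd e S p.1) p.2 <= 1]].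
- have := edge_sum_contract sym irr aS bS eab.
  have cSb : #|S| = #|S :\ b|.+1 by rewrite (cardsD1 b S) bS.
  have [sym' irr' dr' yS' ad'] := apex_contract sym irr dr yS ad bS eab.
  set e' := contract e a b in sym' irr' dr' ad' * => le.
  have IH' : edge_sum e' (S :\ b) + 6 <= 4 * #|S :\ b|.
    by apply: IH => //; [rewrite -cSb | rewrite -ltnS -cSb].
  clear -le IH' cSb codeg; lia.
- have [/eqP->|] := boolP (edge_sum e S == 0); first by clear -S1; lia.
  rewrite -lt0n => /edge_sum_gt0[a [b [aS bS eab]]].
  have N0 : 0 < #|nbhd e S a| by apply/card_gt0P; exists b; rewrite nbhdP bS.
  have := double_apex_bound (x := a) (y := y) (S := nbhd e S a) sym irr dr.
  have -> : e a y by rewrite sym ad.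
  rewrite !nbhdP irr andbF (negbTE yS) => /(_ isT isT isT) H.
  have {}H : edge_sum e (nbhd e S a) + 2 <= 2 * #|nbhd e S a|.
    by apply: H => // z; rewrite nbhdP => /andP[zS ->]; rewrite ad.
  have : 2 * #|nbhd e S a| <= edge_sum e (nbhd e S a).
    apply: edge_sum_ge => u; rewrite nbhdP => /andP[uS eau].
    by move: nex; rewrite negb_exists => /forallP/(_ (a, u)); rewrite /= aS uS eau /= -ltnNge.
  by clear -H N0; lia.
Qed.

(* An outerplanar graph with 6 vertices and 9 edges is not cubic. *)
Lemma apex_six e y S :
  symmetric e -> irreflexive e -> chain_drawable e ->
  y \notin S -> (forall z, z \in S -> e y z) ->
  #|S| = 6 -> 18 <= edge_sum e S -> exists2 x, x \in S & 4 <= deg e S x.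
Proof.
move=> sym irr dr yS ad S6 ge18.
have [/exists_inP//|/exists_inPn nex] := boolP [exists x in S, 4 <= deg e S x].
exfalso.
have le3 x : x \in S -> deg e S x <= 3 by move=> /nex; rewrite -leqNgt.
have eq3 x : x \in S -> deg e S x = 3.
  move=> xS; have := ge18; rewrite /edge_sum (big_setD1 x) //=.
  have := cardsD1 x S; rewrite xS S6 add1n => -[cS].
  have : \sum_(z in S :\ x) deg e S z <= \sum_(z in S :\ x) 3.
    by apply: leq_sum => z /setD1P[_]; apply: le3.
  by rewrite sum_nat_const -cS; have := le3 x xS; clear; lia.
(* Otherwise a contraction leaves five vertices with [edge_sum] at least 16, above 4 * 5 - 6 =
   14. *)
have tri a b : a \in S -> b \in S -> e a b -> 0 < deg e (nbhd e S a) b.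
  move=> aS bS eab; rewrite lt0n; apply/eqP => c0.
  have := edge_sum_contract sym irr aS bS eab; rewrite c0.
  have [sym' irr' dr' yS' ad'] := apex_contract sym irr dr yS ad bS eab.
  have := apex_bound sym' irr' dr' yS' ad'.
  have := cardsD1 b S; rewrite bS S6 add1n => -[<-] /(_ isT).
  by clear -ge18; lia.
have [x xS] : exists x, x \in S by apply/card_gt0P; rewrite S6.
pose N := nbhd e S x.
have NS z : z \in N -> z \in S by rewrite nbhdP => /andP[].
have cN : #|N| = 3 by apply: eq3.
have xN : x \notin N by rewrite nbhdP irr andbF.
(* The sum is at least 3, at most 4, and even. *)
have eN : edge_sum e N = 4.
  have := double_apex_bound (x := x) (y := y) (S := N) sym irr dr.
  rewrite sym ad // xN nbhdP (negbTE yS) cN => /(_ isT isT isT) H.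
  have {}H : edge_sum e N + 2 <= 2 * 3.
    by apply: H => // z zN; rewrite ad ?NS // andbT; move: zN; rewrite nbhdP => /andP[].
  have : 1 * #|N| <= edge_sum e N.
    by apply: edge_sum_ge => u; rewrite nbhdP => /andP[uS eau]; apply: tri.
  have := edge_sum_even sym irr N; rewrite cN; clear -H; lia.
(* [X] has inner sum 10 and degree total 12, so two edges leave it. The other two vertices span a
   sum of at most 2, and 2 + 10 + 4 < 18. *)
pose X := x |: N.
have XN : X :\ x = N by rewrite setU1K.
have XS : X \subset S by rewrite subUset sub1set xS; apply/subsetP.
have cX : #|X| = 4 by rewrite cardsU1 xN cN.
have xX : x \in X by rewrite setU11.
have dX : deg e X x = 3.
  rewrite -(deg_setD1 irr xX) XN -cN; congr #|pred_of_set _|.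
  by apply/setP => z; rewrite /N !nbhdP -andbA andbb.
have eX : edge_sum e X = 10 by rewrite (edge_sum_setD1 sym irr xX) XN eN dX.
have cR : #|S :\: X| = 2 by rewrite cardsD (setIidPr XS) cX S6.
have eR : edge_sum e (S :\: X) <= 1 * 2.
  by rewrite -cR; apply: edge_sum_le => z /(deg_lt irr); rewrite cR.
have : \sum_(z in X) deg e S z = 12.
  by rewrite (eq_bigr (fun=> 3)) ?sum_nat_const ?cX // => z /(subsetP XS); apply: eq3.
rewrite (eq_bigr _ (fun z _ => deg_setD e z XS)) big_split /= -/(edge_sum e X).
have := edge_sum_setD sym XS; rewrite eX; clear -eR ge18.
move: (\sum_(z in X) _); lia.
Qed.
End SmallMinors.

(** * Graphs without S_{2,5} *)

Lemma double_star25_embed (T : finType) (e : rel T) (S : {set T}) x y a b :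
  symmetric e -> irreflexive e -> e x y -> e x a -> e x b ->
  a != b -> a != y -> b != y -> 5 < #|nbhd e S y :\: [set a; b]| ->
  contains_subgraph (double_star 2 5) e.
Proof.
move=> sym irr exy exa exb ab ay yb cB.
have neq u v : e u v -> u != v by apply: contraTneq => ->; rewrite irr.
pose B := nbhd e S y :\: [set a; b] :\ x.
have B5 : 4 < #|B|.
  by move: cB; rewrite (cardsD1 x); case: (x \in _); rewrite -/B; lia.
have BP z : z \in B -> [/\ z != x, z != a, z != b & e y z].
  by rewrite !inE negb_or => /and3P[zx /andP[za zb] /andP[_ yz]].
(* [s] follows the vertex numbering of [double_star 2 5]; only the first five entries of [enum B]
   are used. *)
pose s := [:: x; y; a; b] ++ enum B.
have us : uniq s.
  rewrite cat_uniq enum_uniq andbT; apply/andP; split.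
    by rewrite /= !inE !negb_or (neq _ _ exy) (neq _ _ exa) (neq _ _ exb) (eq_sym y a) (eq_sym y b) ay yb ab.
  apply/hasPn => z; rewrite mem_enum => /BP[zx za zb yz].
  by rewrite !inE !negb_or zx za zb eq_sym neq.
have ss : 8 < size s by rewrite size_cat -cardE /=; lia.
have arc (i j : 'I_(2 + 5).+2) : ds_arc i j -> e (nth x s i) (nth x s j).
  have nB k : 3 < k < 9 -> e y (nth x s k).
    move=> /andP[k3 k9]; have : nth x s k \in enum B.
      rewrite nth_cat /= ltnNge k3 /=; apply: mem_nth.
      by rewrite -cardE; lia.
    by rewrite mem_enum => /BP[].
  case/or3P.
  - by case/andP=> /eqP-> /eqP->.
  - by case/andP=> /andP[/eqP->]; case: j => [[|[|[|[|]]]]].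
  - by case/andP=> /eqP-> j4; apply: nB; rewrite j4 ltn_ord.
exists (fun i : 'I_(2 + 5).+2 => nth x s i); split.
  move=> i j /eqP; rewrite nth_uniq ?(leq_trans (ltn_ord _)) // => /eqP; exact: val_inj.
by move=> i j /orP[/arc //|/arc]; rewrite sym.
Qed.

Lemma set2_of_card (T : finType) (A : {set T}) : 1 < #|A| ->
  exists a b, [/\ a \in A, b \in A & a != b].
Proof. by move=> /card_gt1P[a [b []]]; exists a, b. Qed.

Section DoubleStarFree.
Variables (T : finType) (e : rel T).
Hypotheses (sym : symmetric e) (irr : irreflexive e) (dr : chain_drawable e).
Hypothesis free : ~ contains_subgraph (double_star 2 5) e.
Implicit Types (S : {set T}) (x y : T).

Lemma free_bound S x y a b : e y x -> e x a -> e x b -> a != b -> a != y -> b != y ->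
  #|nbhd e S y :\: [set a; b]| <= 5.
Proof.
move=> eyx exa exb ab ay yb; rewrite leqNgt; apply/negP => H; apply: free.
by apply: (double_star25_embed (x := x) (y := y)) H => //; rewrite sym.
Qed.

Definition closed_nbhd S y : {set T} := y |: nbhd e S y.

Lemma closed_nbhd_sub S y : y \in S -> closed_nbhd S y \subset S.
Proof.
by move=> yS; rewrite subUset sub1set yS; apply/subsetP => z; rewrite nbhdP => /andP[].
Qed.

Lemma notin_nbhd S y : y \notin nbhd e S y.
Proof. by rewrite nbhdP irr andbF. Qed.

Lemma card_closed_nbhd S y : #|closed_nbhd S y| = (deg e S y).+1.
Proof. by rewrite cardsU1 notin_nbhd. Qed.

Lemma edge_sum_closed_nbhd S y :
  edge_sum e (closed_nbhd S y) = edge_sum e (nbhd e S y) + 2 * deg e S y.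
Proof.
have yX : y \in closed_nbhd S y by rewrite setU11.
rewrite (edge_sum_setD1 sym irr yX) -(deg_setD1 irr yX) setU1K ?notin_nbhd //.
congr (_ + 2 * #|pred_of_set _|).
by apply/setP => z; rewrite !nbhdP -andbA andbb.
Qed.

Lemma nbhd_outP S y w x : w \in nbhd e (S :\: closed_nbhd S y) x ->
  [/\ w \in S, w != y, ~~ e y w & e x w].
Proof.
rewrite !inE => /andP[/andP[]]; rewrite negb_or negb_and => /andP[wy].
by case: (w \in S) => //= nyw _ xw.
Qed.

(** A neighbor [x] of [y] has two further neighbors [a], [b]. If [y] had degree 8, at least six of
    its neighbors would avoid [a] and [b], one too many for [free_bound]. *)
Lemma deg_lt8 S y : (forall x, x \in S -> 2 < deg e S x) -> y \in S -> deg e S y < 8.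
Proof.
move=> d3 yS; rewrite ltnNge; apply/negP => d8.
have /card_gt0P[x] : 0 < deg e S y by lia.
rewrite nbhdP => /andP[xS eyx].
have [|a [b [/setD1P[ay aN] /setD1P[yb bN] ab]]] := @set2_of_card _ (nbhd e S x :\ y).
  have := d3 x xS; rewrite /deg (cardsD1 y); case: (y \in _); lia.
move: aN bN; rewrite !nbhdP => /andP[_ xa] /andP[_ xb].
have := free_bound S eyx xa xb ab ay yb.
have := cardsD (nbhd e S y) [set a; b].
have : #|nbhd e S y :&: [set a; b]| <= 2.
  by rewrite (leq_trans (subset_leq_card (subsetIr _ _))) // cards2 ab.
by move: d8; rewrite /deg; lia.
Qed.

(** With an outer neighbor [w] as one leaf of [x], only the other leaf can cost [y] a neighbor, and
    at least six remain. *)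
Lemma no_out_deg7 S x y : (forall x, x \in S -> 2 < deg e S x) ->
  6 < deg e S y -> x \in nbhd e S y -> deg e (S :\: closed_nbhd S y) x = 0.
Proof.
move=> d3 d7; rewrite nbhdP => /andP[xS eyx]; apply/eqP; rewrite -leqn0 leqNgt.
apply/negP => /card_gt0P[w /nbhd_outP[wS wy nyw xw]].
have /card_gt0P[b] : 0 < #|nbhd e S x :\ y :\ w|.
  have := d3 x xS; rewrite /deg (cardsD1 y) (cardsD1 w).
  by do 2!case: (_ \in _); lia.
rewrite 2!in_setD1 nbhdP => /and4P[bw yb _ xb].
have := free_bound S eyx xw xb; rewrite eq_sym => /(_ bw wy yb).
have -> : nbhd e S y :\: [set w; b] = nbhd e S y :\ b.
  apply/setP => z; rewrite !inE negb_or; have [->|] := eqVneq z w => //.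
  by rewrite (negbTE nyw) !andbF.
have := cardsD1 b (nbhd e S y); move: d7; rewrite /deg; case: (b \in _); lia.
Qed.

(** Two outer neighbors as leaves of [x] would cost [y] none of its at least six neighbors. *)
Lemma out_deg6 S x y : 5 < deg e S y -> x \in nbhd e S y ->
  deg e (S :\: closed_nbhd S y) x <= 1.
Proof.
move=> d6; rewrite nbhdP => /andP[xS eyx]; rewrite leqNgt; apply/negP.
move=> /set2_of_card[a [b [/nbhd_outP[_ ay nya xa] /nbhd_outP[_ yb nyb xb] ab]]].
have := free_bound S eyx xa xb ab ay yb.
have -> : nbhd e S y :\: [set a; b] = nbhd e S y.
  apply/setP => z; rewrite !inE negb_or.
  have [->|] := eqVneq z a; first by rewrite (negbTE nya) !andbF.
  by have [->|] := eqVneq z b => //; rewrite (negbTE nyb) !andbF.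
by rewrite leqNgt d6.
Qed.

(** Since [edge_sum] counts edges twice, deleting k vertices may cost at most 40k/7. *)
Lemma double_star_free_bound S : 7 * edge_sum e S <= 40 * #|S|.
Proof.
have [m] := ubnP #|S|; elim: m S => // m IH S leS.
have [/exists_inP[x xS dx]|/exists_inPn nd2] := boolP [exists x in S, deg e S x <= 2].
  have := edge_sum_setD1 sym irr xS.
  have cS := cardsD1 x S; rewrite xS add1n in cS.
  have := IH (S :\ x); rewrite -ltnS -cS => /(_ leS).
  by rewrite cS; clear -dx; lia.
have d3 x : x \in S -> 2 < deg e S x by move=> /nd2; rewrite -ltnNge.
have del (X : {set T}) (XS : X \subset S) : 0 < #|X| ->
    7 * edge_sum e (S :\: X) + 40 * #|X| <= 40 * #|S|.
  move=> X0; have := cardsD S X; rewrite (setIidPr XS) => cD.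
  have cX := subset_leq_card XS.
  have := IH (S :\: X) ltac:(by clear -cD cX X0 leS; lia).
  by clear -cD cX; lia.
have edge_nbhd x y : x \in nbhd e S y -> e y x by rewrite nbhdP => /andP[].
have split_nbhd y : y \in S -> edge_sum e S = edge_sum e (S :\: closed_nbhd S y) +
   edge_sum e (nbhd e S y) + 2 * deg e S y +
   2 * \sum_(x in nbhd e S y) deg e (S :\: closed_nbhd S y) x.
  move=> yS; have dy0 : deg e (S :\: closed_nbhd S y) y = 0.
    apply/eqP; rewrite cards_eq0; apply/eqP/setP => z; rewrite in_set0.
    by apply/negP => /nbhd_outP[_ _ /negP].
  rewrite (edge_sum_setD sym (closed_nbhd_sub yS)) edge_sum_closed_nbhd.
  by rewrite big_setU1 ?notin_nbhd //= dy0 add0n addnA.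
(* In degree 7 no edge leaves the eight vertices of N[y]; they cost at most 22 + 14 = 36, and 7 * 36
   <= 40 * 8. *)
have [/exists_inP[y yS d7]|/exists_inPn nd7] := boolP [exists y in S, 6 < deg e S y].
  have d7' : deg e S y = 7 by apply/eqP; rewrite eqn_leq d7 -ltnS deg_lt8.
  have := split_nbhd y yS.
  rewrite big1 => [|x xN]; last exact: no_out_deg7.
  have := apex_bound sym irr dr (notin_nbhd S y) (edge_nbhd^~ y).
  have := del _ (closed_nbhd_sub yS); rewrite card_closed_nbhd.
  rewrite -/(deg e S y) d7' => /(_ isT) + /(_ isT); clear; lia.
have d6 x : x \in S -> deg e S x <= 6 by move=> /nd7; rewrite -leqNgt.
have [/exists_inP[y yS d5]|/exists_inPn nd6] := boolP [exists y in S, 5 < deg e S y]; last first.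
  have : edge_sum e S <= 5 * #|S| by apply: edge_sum_le => x /nd6; rewrite -leqNgt.
  by clear; lia.
have dy : deg e S y = 6 by apply/eqP; rewrite eqn_leq d5 d6.
have sN := split_nbhd y yS.
set N := nbhd e S y in sN; set X := closed_nbhd S y in sN.
have cN : #|N| = 6 by [].
have NS z : z \in N -> z \in S by rewrite nbhdP => /andP[].
have out1 x : x \in N -> deg e (S :\: X) x <= 1 by apply: out_deg6; rewrite dy.
have out6 : \sum_(x in N) deg e (S :\: X) x <= 6.
  by rewrite -[leqRHS]muln1 -[in leqRHS]cN -sum_nat_const; apply: leq_sum.
have XS : X \subset S by exact: closed_nbhd_sub.
have cX : #|X| = 7 by rewrite card_closed_nbhd dy.
have delX := del X XS; rewrite cX in delX; have {}delX := delX isT.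
have eN := apex_bound sym irr dr (notin_nbhd S y) (edge_nbhd^~ y); rewrite -/N cN in eN.
have {}eN : edge_sum e N <= 18 by have := eN isT; clear; lia.
rewrite dy in sN.
(* 28 is the allowance 40 for seven vertices minus 12 for the six edges at [y]. *)
have [small|big] := leqP (edge_sum e N + 2 * \sum_(x in N) deg e (S :\: X) x) 28.
  by clear -sN delX small; lia.
(* With an even sum of at most 18 and at most 6 edges going out, exceeding 28 forces 18 and 6. *)
have eN18 : edge_sum e N = 18.
  have := edge_sum_even sym irr N; clear -eN out6 big; lia.
have o6 : \sum_(x in N) deg e (S :\: X) x = 6 by clear -out6 big eN; lia.
have [x xN dx] := apex_six sym irr dr (notin_nbhd S y) (edge_nbhd^~ y) cN (eq_leq (esym eN18)).
rewrite -/N in xN dx.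
have ox : deg e (S :\: X) x = 1.
  apply/eqP; rewrite eqn_leq out1 //=; move: o6; rewrite (big_setD1 x) //=.
  have : \sum_(z in N :\ x) deg e (S :\: X) z <= \sum_(z in N :\ x) 1.
    by apply: leq_sum => z /setD1P[_]; apply: out1.
  rewrite sum_nat_const muln1; have := cardsD1 x N; rewrite xN cN; clear; lia.
have /card_gt0P[w wx] : 0 < deg e (S :\: X) x by rewrite ox.
have [wS wy nyw xw] := nbhd_outP wx.
have xS := NS x xN.
have eyx : e y x by exact: edge_nbhd.
have dSx : deg e S x = deg e N x + 2.
  rewrite (deg_setD e x XS) ox (@deg_setD _ e X [set y]) ?sub1set ?setU11 //.
  by rewrite setU1K ?notin_nbhd // -/N [deg e [set y] x]degE big_set1 sym eyx -addnA addnCA.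
have d6x : deg e S x = 6 by apply/eqP; rewrite eqn_leq d6 //= dSx; clear -dx; lia.
(* [w] is the only neighbor of [x] outside [X]. *)
have subx : closed_nbhd S x \subset w |: X.
  apply/subsetP => z; rewrite 2!in_setU1 => /orP[/eqP->|zN].
    by rewrite in_setU1 xN !orbT.
  have [//|zw] := eqVneq z w; apply: contraT => /= zX.
  have : [set z; w] \subset nbhd e (S :\: X) x.
    apply/subsetP => u; rewrite in_set2 => /orP[]/eqP-> //.
    by rewrite nbhdP in_setD zX /=; move: zN; rewrite nbhdP.
  by move/subset_leq_card; rewrite cards2 zw -/(deg e _ x) ox.
have wSX : w \in S :\: X by move: wx; rewrite nbhdP => /andP[].
(* Apply [out_deg6] around [x], also of degree 6: [w] has at most one neighbor outside N[x], and
   N[x] lies in [w |: X]. *)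
have dw : deg e (S :\: X) w <= 1.
  apply: (leq_trans _ (@out_deg6 S w x _ _)); rewrite ?d6x ?nbhdP ?wS //.
  rewrite -(deg_setD1 irr wSX); apply/subset_leq_card/subsetP => z.
  rewrite !nbhdP => /andP[/setD1P[zw /setDP[zS zX]] ->]; rewrite andbT in_setD zS andbT.
  by apply: contra zX => /(subsetP subx); rewrite in_setU1 (negbTE zw).
have wXS : w |: X \subset S by rewrite subUset sub1set wS.
(* The eight vertices cost at most 18 + 12 + 12 + 2 = 44, and 7 * 44 = 308 <= 320. *)
have := del _ wXS; rewrite cardsU1 cX; have [_ ->] := setDP wSX => /(_ isT).
have := edge_sum_setD1 sym irr wSX.
have -> : S :\: X :\ w = S :\: (w |: X) by rewrite setDDl setUC.
clear -dw sN eN18 o6; lia.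
Qed.

End DoubleStarFree.

Lemma num_edgesE n (e : rel 'I_n) :
  symmetric e -> irreflexive e -> edge_sum e [set: 'I_n] = 2 * num_edges e.
Proof.
move=> sym irr.
have -> : num_edges e = \sum_(x < n) \sum_(z < n) (x < z) && e x z.
  rewrite pair_bigA /= /num_edges -sum1dep_card big_mkcond.
  by apply: eq_bigr => p _; case: (_ && _).
(* Swapping the summation variables in one copy makes each edge count once per orientation. *)
rewrite mul2n -addnn [X in X + _]exchange_big -big_split /edge_sum /=.
rewrite (eq_bigl xpredT) => [|x]; last exact: in_setT.
apply: eq_bigr => x _; rewrite degE -big_split /= (eq_bigl xpredT) => [|z]; last exact: in_setT.
apply: eq_bigr => z _; rewrite sym.
by have [|| /val_inj->] := ltngtP; rewrite ?irr ?addn0.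
Qed.

(* ex_P(n, S_{2,5}) <= 20n/7: every n-vertex planar simple graph with no
   subgraph isomorphic to S_{2,5} has at most 20n/7 edges. *)
Theorem theorem1p1 :
  forall (n : nat), (1 <= n)%N ->
  forall e : rel 'I_n,
    simple_graph e ->
    planar e ->
    ~ contains_subgraph (double_star 2 5) e ->
    (7 * num_edges e <= 20 * n)%N.
Proof.
move=> n _ e sg pl free; have dr := planar_chain_drawable sg pl.
have [sym nirr] := sg; have irr : irreflexive e by move=> x; apply: negbTE.
have := double_star_free_bound sym irr dr free [set: 'I_n].
rewrite cardsT card_ord num_edgesE //; lia.
Qed.
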